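(* Let $M$ be a simplicial complex which is not a simplex and let $K \supsetneq L$ be a pair of simplicial complexes. Suppose that $\mathcal{Z}^*_M(K,L)$ is shellable. Then there exists a pair $(\sigma,\tau)$ of $\sigma \in \mathbf{F}_K \setminus \mathbf{F}_L$ and $\tau \in \mathbf{F}_L$ such that $$|\sigma \cap \tau| = \max_{\rho \in \mathbf{F}_K \setminus \mathbf{F}_L} |\rho| - 1 .$$
   Context: A simplicial complex $K$ is a collection of finite subsets (simplices) of a set $V(K)$ closed under taking subsets, with $\{v\}\in K$ for all $v\in V(K)$. The dimension is $\dim K=\max_{\sigma\in K}|\sigma|-1$; all simplicial complexes are nonempty (they contain $\emptyset$) and finite-dimensional. A facet is an inclusion-maximal simplex; $\mathbf{F}_X$ denotes the set of all facets of $X$. A complex is pure if all its facets have the same cardinality. A pair of simplicial complexes $K\supset L$ consists of a simplicial complex $K$ and a subcomplex $L$ of $K$ (so $V(L)\subset V(K)$); $K\supsetneq L$ means moreover $K\neq L$. A complex $M$ is a simplex if $V(M)\in M$. $K$ is shellable (in the non-pure sense) if its facets can be arranged in a linear order $F_1,\dots,F_t$ (a shelling) such that for all $k=2,\dots,t$ the subcomplex $\left(\bigcup_{i=1}^{k-1}\langle F_i\rangle\right)\cap\langle F_k\rangle$ is pure and $(|F_k|-2)$-dimensional, where $\langle F\rangle$ is the complex of all subsets of $F$. The join of $K_1,\dots,K_m$ is $K_1*\cdots*K_m=\{\sigma\subset\bigsqcup_{i}V(K_i) : \sigma\cap V(K_i)\in K_i \text{ for all } i\}$. Let $M$ be a simplicial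 complex with vertex set $V(M)=[m]=\{1,\dots,m\}$, $m\ge1$. The polyhedral join is the subcomplex $\mathcal{Z}^*_M(K,L)=\bigcup_{S\in M}X^S_1*\cdots*X^S_m$ of the join of $m$ disjoint copies of $K$, where $X^S_i$ is the $i$-th copy of $K$ if $i\in S$ and the $i$-th copy of $L$ if $i\notin S$. *)

(* Defs.v *)
From HB Require Import structures.
From mathcomp Require Import all_boot all_order all_algebra.
From mathcomp Require Import finmap.
From mathcomp Require Import boolp classical_sets.

Set Implicit Arguments.
Unset Strict Implicit.
Unset Printing Implicit Defensive.

Import GRing.Theory Num.Theory.

Local Open Scope classical_set_scope.

Section Complexes.
Context {T : choiceType}.
Implicit Types (X K : set {fset T}) (s t : {fset T}).

(* A complex is given by its set of simplices.  The vertex set need not be all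
   of [T]: it is recovered from the simplices, see [vertices]. *)
Record simplicial_complex K : Prop := SimplicialComplex {
  complex_fset0 : K fset0;
  complex_closed : forall s t, K s -> (t `<=` s)%fset -> K t;
  complex_findim : exists d : nat, forall s, K s -> (#|` s| <= d)%N }.

Definition vertices K : set T := [set v | K [fset v]%fset].

Definition is_simplex K : Prop :=
  exists2 s, K s & [set` s] = vertices K.

Definition facets K : set {fset T} :=
  [set s | K s /\ forall t, K t -> (s `<=` t)%fset -> t = s].

Definition is_max_card X (n : nat) : Prop :=
  (exists2 s, X s & #|` s| = n) /\ (forall s, X s -> (#|` s| <= n)%N).

(* Integer-valued, since the complex whose only simplex is the empty set has
   dimension -1. *)
Definition has_dim K (d : int) : Prop :=
  exists2 n : nat, is_max_card K n & d = (n%:Z - 1)%R.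

Definition pure K : Prop :=
  forall s t, facets K s -> facets K t -> #|` s| = #|` t|.

Definition full_simplex s : set {fset T} := [set t | (t `<=` s)%fset].

(* Non-pure shellability; positions in the list [F] are counted from 0, so that
   the condition bears on all the facets but the first one. *)
Definition is_shelling K (F : seq {fset T}) : Prop :=
  [/\ uniq F,
      [set` F] = facets K &
      forall k : nat, (0 < k < size F)%N ->
        let Fk := nth fset0 F k in
        let I := (\bigcup_(i in [set i : nat | (i < k)%N])
                    full_simplex (nth fset0 F i)) `&` full_simplex Fk in
        pure I /\ has_dim I (#|` Fk|%:Z - 2)%R].

Definition shellable K : Prop := exists F : seq {fset T}, is_shelling K F.

End Complexes.

Section Joins.
Context {T : choiceType} {m : nat}.

(* The i-th copy of a vertex v is the pair (i, v). *)
Definition slice (s : {fset 'I_m * T}) (i : 'I_m) : {fset T} :=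
  [fset p.2 | p in s & p.1 == i]%fset.

Definition join (K : 'I_m -> set {fset T}) : set {fset 'I_m * T} :=
  [set s | forall i, K i (slice s i)].

Definition polyhedral_join (M : set {fset 'I_m}) (K L : set {fset T}) :
    set {fset 'I_m * T} :=
  \bigcup_(S in M) join (fun i => if i \in S then K else L).

End Joins.

(* Main.v *)
Require Import Defs.
From mathcomp Require Import all_boot all_order all_algebra.
From mathcomp Require Import finmap.
From mathcomp Require Import boolp classical_sets.
From mathcomp Require Import zify.

Set Implicit Arguments.
Unset Strict Implicit.
Unset Printing Implicit Defensive.

Local Open Scope classical_set_scope.

(** Let [n] be the maximal size of a facet of [K] outside [L].  It is enough to
    find such a facet of size [n] with a codimension-one face in [L].  Suppose
    there is none.  For each [i], consider the facets of the polyhedral join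
    whose [i]-th slice has size [n] and is not in [L].  When such a facet is not
    the first one in the shelling, it shares a codimension-one face with an
    earlier facet; the [i]-th slice of that face is still outside [L], which
    forces the earlier facet into the same class.  Hence the first facet of the
    shelling lies in the class of every [i], and the full vertex set of [M] is
    then a simplex. *)

Section Complexes.
Context {T : choiceType}.
Implicit Types (X K L : set {fset T}) (s t : {fset T}).

Lemma ex_max_card X (d : nat) :
  X !=set0 -> (forall s, X s -> (#|` s| <= d)%N) -> exists n, is_max_card X n.
Proof.
move=> [s0 Xs0] Xd.
pose P n := `[< exists2 s, X s & #|` s| = n >].
have exP : exists n, P n by exists #|` s0|; apply/asboolP; exists s0.
have ubP n : P n -> (n <= d)%N by move=> /asboolP[s Xs <-]; exact: Xd.
case: (ex_maxnP exP ubP) => n /asboolP Pn nmax; exists n; split=> // s Xs.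
by apply: nmax; apply/asboolP; exists s.
Qed.

Lemma sub_facet K (d : nat) s : (forall t, K t -> (#|` t| <= d)%N) -> K s ->
  exists2 t, facets K t & (s `<=` t)%fset.
Proof.
move=> Kd Ks.
have [||n [[t [Kt st] <-] tmax]] :=
    ex_max_card (X := [set t | K t /\ (s `<=` t)%fset]) (d := d).
- by exists s; split.
- by move=> t [Kt _]; exact: Kd.
exists t => //; split=> // u Ku tu; apply/eqP; rewrite eq_sym eqEfcard tu /=.
by apply: tmax; split=> //; exact: fsubset_trans tu.
Qed.

(** A facet of [K] that lies in [L] is maximal in [L] as well, since [L] has no simplices outside
    [K]. *)
Lemma facetsD K L s : L `<=` K ->
  (facets K `\` facets L) s <-> facets K s /\ ~ L s.
Proof.
move=> LK; split=> -[Ks nLs]; split=> //; last by case.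
by move=> Ls; apply: nLs; split=> // t Lt; apply: Ks.2; exact: LK.
Qed.

(** The intersection in the shelling condition has dimension [|F_k| - 2], so a largest simplex [t]
    in it has [|F_k| - 1] elements. *)
Lemma shelling_codim1 K F k : is_shelling K F -> (0 < k < size F)%N ->
  exists t i, [/\ (i < k)%N, (t `<=` nth fset0 F i)%fset,
    (t `<=` nth fset0 F k)%fset & #|` nth fset0 F k| = #|` t|.+1].
Proof.
move=> [_ _ shF] /shF[_ [n [[t [[i ik ti] tk] tn] _] Fn]].
by exists t, i; split=> //; lia.
Qed.

End Complexes.

Section Joins.
Context {T : choiceType} {m : nat}.
Implicit Types (s t : {fset 'I_m * T}) (M : set {fset 'I_m}) (K L : set {fset T}).

Lemma in_slice s i x : (x \in slice s i) = ((i, x) \in s).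
Proof.
apply/imfsetP/idP => [[[j y] /=]|sx].
  by rewrite !inE /= => /andP[sy /eqP ji] ->; rewrite -ji.
by exists (i, x); rewrite //= !inE sx eqxx.
Qed.

Lemma slice_sub s t i : (s `<=` t)%fset -> (slice s i `<=` slice t i)%fset.
Proof. by move=> /fsubsetP st; apply/fsubsetP=> x; rewrite !in_slice => /st. Qed.

Lemma card_slices s : #|` s| = (\sum_i #|` slice s i|)%N.
Proof.
rewrite -sum1_size (partition_big fst predT) //=; apply: eq_bigr => i _.
rewrite sum1_count -size_filter -(size_map snd); apply/perm_size/uniq_perm => //.
  rewrite map_inj_in_uniq ?filter_uniq ?fset_uniq // => -[j x] [k y].
  by rewrite !mem_filter /= => /andP[/eqP-> _] /andP[/eqP-> _] ->.
move=> x; rewrite in_slice; apply/mapP/idP => [[[j y]]|sx].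
  by rewrite mem_filter /= => /andP[/eqP-> sy] ->.
by exists (i, x); rewrite // mem_filter /= eqxx.
Qed.

(** Slice sizes add up and no slice of [t] exceeds that of [s], so the single lost vertex is the
    only possible defect. *)
Lemma card_slice_codim1 s t i : (t `<=` s)%fset -> #|` s| = #|` t|.+1 ->
  (#|` slice s i| <= #|` slice t i|.+1)%N.
Proof.
move=> ts; rewrite !card_slices (bigD1 i) //= [in RHS](bigD1 i) //=.
move=> st; rewrite -(leq_add2r (\sum_(j | j != i) #|` slice s j|)) st -addSn.
by rewrite leq_add2l; apply: leq_sum => j _; apply/fsubset_leq_card/slice_sub.
Qed.

Definition support L s : {fset 'I_m} := [fset i | i : 'I_m & `[< ~ L (slice s i) >]]%fset.

Lemma supportP L s i : reflect (~ L (slice s i)) (i \in support L s).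
Proof. by rewrite !inE /=; exact: asboolP. Qed.

(** Every [S] witnessing membership contains [support L s]; as [M] is closed under subsets, this
    least candidate can replace [S]. *)
Lemma polyhedral_joinE M K L s : simplicial_complex M -> L `<=` K ->
  polyhedral_join M K L s <-> (forall i, K (slice s i)) /\ M (support L s).
Proof.
move=> cM LK; split=> [[S MS js]|[Ks Ms]].
  split=> [i|]; first by move: (js i); case: ifP => // _ /LK.
  apply: (complex_closed cM MS); apply/fsubsetP=> i /supportP nL.
  by move: (js i); case: ifP.
exists (support L s) => // i; case: ifPn => // /supportP.
by move/contrapT.
Qed.

Lemma polyhedral_join_bounded M K L : simplicial_complex M ->
  simplicial_complex K -> L `<=` K ->
  exists d : nat, forall s, polyhedral_join M K L s -> (#|` s| <= d)%N.
Proof.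
move=> cM cK LK; have [d Kd] := complex_findim cK.
exists (m * d)%N => s /(polyhedral_joinE _ cM LK)[Ks _].
rewrite card_slices -[m in (m * d)%N]card_ord -sum_nat_const.
by apply: leq_sum => i _; exact: Kd.
Qed.

Lemma slice_layer (r : {fset T}) (i j : 'I_m) :
  slice [fset (i, x) | x in r]%fset j = if j == i then r else fset0.
Proof.
apply/fsetP=> y; rewrite in_slice; apply/imfsetP/idP => [[x /= rx [-> ->]]|].
  by rewrite eqxx.
by case: eqP => // -> ry; exists y.
Qed.

Lemma slice_fsetU s t i : slice (s `|` t)%fset i = (slice s i `|` slice t i)%fset.
Proof. by apply/fsetP=> x; rewrite !(inE, in_slice). Qed.

Lemma polyhedral_join_layer M K L (r : {fset T}) (i : 'I_m) :
  simplicial_complex M ->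
  simplicial_complex K -> simplicial_complex L -> L `<=` K ->
  vertices M = setT -> K r -> polyhedral_join M K L [fset (i, x) | x in r]%fset.
Proof.
move=> cM cK cL LK VM Kr; apply/polyhedral_joinE => //; split=> [j|].
  by rewrite slice_layer; case: eqP => _ //; exact: complex_fset0 cK.
have Mi : M [fset i]%fset by have : vertices M i by rewrite VM.
apply: (complex_closed cM Mi); apply/fsubsetP=> j /supportP.
rewrite slice_layer in_fset1; case: eqP => // _ nL.
by case: nL; exact: complex_fset0 cL.
Qed.

(* Enlarging a slice that is already outside [L] does not enlarge the support. *)
Lemma slice_facet M K L s i : simplicial_complex M -> L `<=` K ->
  facets (polyhedral_join M K L) s -> ~ L (slice s i) ->
  facets K (slice s i).
Proof.
move=> cM LK [/(polyhedral_joinE _ cM LK)[Ks Ms] smax] nLsi.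
split=> // r Kr sir.
pose s' := (s `|` [fset (i, x) | x in r])%fset.
have s'i : slice s' i = r by rewrite slice_fsetU slice_layer eqxx; apply/fsetUidPr.
have s'j j : j != i -> slice s' j = slice s j.
  by move=> ji; rewrite slice_fsetU slice_layer (negbTE ji) fsetU0.
rewrite -s'i (smax s') ?fsubsetUl //; apply/polyhedral_joinE => //; split=> [j|].
  by case: (eqVneq j i) => [->|/s'j ->]; rewrite ?s'i.
apply: (complex_closed cM Ms); apply/fsubsetP=> j /supportP nLj; apply/supportP.
by case: (eqVneq j i) => [->//|/s'j <-].
Qed.

End Joins.

Theorem theorem4p9 (m : nat) (M : set {fset 'I_m})
  (T : choiceType) (K L : set {fset T})
  (hm : (1 <= m)%N)
  (hM : simplicial_complex M) (hVM : vertices M = setT)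
  (hMns : ~ is_simplex M)
  (hK : simplicial_complex K) (hL : simplicial_complex L) (hLK : L `<` K)
  (hsh : shellable (polyhedral_join M K L)) :
  exists s t : {fset T},
    [/\ (facets K `\` facets L) s, facets L t &
        exists2 n : nat, is_max_card (facets K `\` facets L) n &
          (#|` (s `&` t)%fset|%:Z = n%:Z - 1)%R].
Proof.
have [LK /existsNP[r0 /not_implyP[Kr0 nLr0]]] := hLK.
have [d Kd] := complex_findim hK; have [e Ze] := polyhedral_join_bounded hM hK LK.
have [n nmax] : exists n, is_max_card (facets K `\` facets L) n.
  apply: (ex_max_card (d := d)) => [|s [[/Kd]]//].
  have [s Ks r0s] := sub_facet Kd Kr0.
  exists s; apply/facetsD => //; split=> // Ls.
  exact/nLr0/(complex_closed hL Ls).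
have [[s0 /(facetsD _ LK)[Ks0 nLs0] s0n] ltn] := nmax.
have [[s [u [[Ks nLs] Lu us sn un]]]|noface] :=
  pselect (exists s u, [/\ facets K s /\ ~ L s, L u, (u `<=` s)%fset,
                           #|` s| = n & (n <= #|` u|.+1)%N]).
  (* The intersection of [s] and [t] contains [u], and it is not all of [s] because [s] is outside
     [L]; its size is therefore exactly [n - 1]. *)
  have [t Lt ut] := sub_facet (fun t Lt => Kd t (LK t Lt)) Lu.
  exists s, t; split=> //; first exact/facetsD.
  exists n => //.
  have : (#|` u| <= #|` (s `&` t)%fset|)%N.
    by apply: fsubset_leq_card; rewrite fsubsetI us.
  have : (#|` (s `&` t)%fset| < #|` s|)%N.
    apply: fproper_ltn_card; rewrite fproperEneq fsubsetIl andbT.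
    apply: contra_not_neq nLs => stE.
    by apply: (complex_closed hL Lt.1); rewrite -stE fsubsetIr.
  lia.
exfalso; have [F shF] := hsh; have [_ FE _] := shF.
pose C (i : 'I_m) s := ~ L (slice s i) /\ #|` slice s i| = n.
have facet_nth k : (k < size F)%N ->
    facets (polyhedral_join M K L) (nth fset0 F k).
  by move=> kF; rewrite -FE; exact: mem_nth.
have C0 i k : (k < size F)%N -> C i (nth fset0 F k) ->
    (0 < size F)%N /\ C i (nth fset0 F 0).
  elim/ltn_ind: k => -[//|k] IH kF [nLk kn].
  have [t [j [jk tj tk kt]]] := shelling_codim1 (k := k.+1) shF kF.
  have jF : (j < size F)%N by exact: ltn_trans kF.
  apply: (IH j) => //.
  have Kk := slice_facet hM LK (facet_nth _ kF) nLk.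
  have tn := card_slice_codim1 i tk kt.
  have tik := slice_sub i tk; have tij := slice_sub i tj.
  (* Otherwise [slice t i], of size at least [n - 1], would be a face of the kind excluded by
     [noface]. *)
  have nLt : ~ L (slice t i).
    by move=> Lt; apply: noface; exists (slice (nth fset0 F k.+1) i), (slice t i);
       split=> //; rewrite -kn.
  have nLj : ~ L (slice (nth fset0 F j) i).
    by move=> Lj; exact/nLt/(complex_closed hL Lj).
  have Kj := slice_facet hM LK (facet_nth _ jF) nLj.
  split=> //; apply/eqP; rewrite eqn_leq ltn /=; last exact/facetsD.
  (* If the earlier slice were smaller than [n], it would coincide with [slice t i] and so lie
     inside the later slice; being a facet of [K], it would equal that slice, which has size [n]. *)
  rewrite -kn leqNgt; apply/negP => jlt.
  have ij : slice t i = slice (nth fset0 F j) i.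
    by apply/eqP; rewrite eqEfcard tij -ltnS (leq_trans jlt).
  by move: jlt; rewrite -(Kj.2 _ Kk.1) ?ltnn // -ij.
have CF0 i : (0 < size F)%N /\ C i (nth fset0 F 0).
  (* The class of [i] is nonempty: put [s0] in the [i]-th copy and extend to a facet, whose [i]-th
     slice is still [s0] by maximality of [s0] in [K]. *)
  have [s Zs s0s] := sub_facet Ze (polyhedral_join_layer i hM hK hL LK hVM Ks0.1).
  have {}s0s : (s0 `<=` slice s i)%fset.
    by have := slice_sub i s0s; rewrite slice_layer eqxx.
  have nLs : ~ L (slice s i) by move=> Ls; exact/nLs0/(complex_closed hL Ls).
  have sE : slice s i = s0.
    by apply: Ks0.2 => //; exact: (slice_facet hM LK Zs nLs).1.
  have sF : s \in F by have : [set` F] s by rewrite FE.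
  apply: (C0 i (index s F)); rewrite ?index_mem ?nth_index //.
  by split; rewrite sE.
have [F0 _] := CF0 (Ordinal hm).
have [/(polyhedral_joinE _ hM LK)[_ MF0] _] := facet_nth _ F0.
(* The first facet has every slice outside [L], so its support, a simplex of [M], is the whole
   vertex set. *)
apply: hMns; exists (support L (nth fset0 F 0)) => //.
rewrite hVM; apply/seteqP; split=> // i _ /=.
by apply/supportP; have [_ []] := CF0 i.
Qed.
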